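(* Let $k\ge 2$ be a fixed integer and let $p^*(n)=(k-1)\frac{\ln n}{n}$. Then $p^*$ is a threshold function for the event that the random $k$-uniform hypergraph $H^k_{n,p}$ is rainbow-free colourable. That is, for every function $p:\mathbb N\to[0,1]$: (i) if $p(n)\ll p^*(n)$, then $\lim_{n\to\infty}\Pr[H^k_{n,p}\text{ is rainbow-free colourable}]=1$; (ii) if $p(n)\gg p^*(n)$, then $\lim_{n\to\infty}\Pr[H^k_{n,p}\text{ is rainbow-free colourable}]=0$.
   Context: A $k$-uniform hypergraph $H$ consists of a vertex set $V(H)$ and a collection $E(H)$ of $k$-element subsets of $V(H)$, called hyperedges. Write $[k]=\{1,\dots,k\}$. A $k$-colouring of $H$ is a map $c:V(H)\to[k]$. It is rainbow-free if it is surjective onto $[k]$ and $c(e)=\{c(v): v\in e\}\ne[k]$ for every hyperedge $e\in E(H)$. A $k$-uniform hypergraph is rainbow-free colourable if it has a rainbow-free $k$-colouring. For $p:\mathbb N\to[0,1]$, the random $k$-uniform hypergraph $H^k_{n,p}$ has a vertex set $V$ with $|V|=n$, and each $k$-element subset of $V$ is a hyperedge with probability $p=p(n)$, independently of all others. A function $r(n)$ is a threshold function for a hypergraph property $A$ if (i) $\Pr[H^k_{n,p}\models A]\to 0$ whenever $p(n)\ll r(n)$, and (ii) $\Pr[H^k_{n,p}\models A]\to 1$ whenever $p(n)\gg r(n)$, or vice versa (limits $0$ and $1$ interchanged). Here $f(n)\ll g(n)$ (equivalently $g(n)\gg f(n)$) means $f(n)/g(n)\to0$ as $n\to\infty$.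 *)

(* Defs.v *)
From HB Require Import structures.
From mathcomp Require Import all_boot all_order all_algebra.
From mathcomp Require Import all_classical all_reals all_analysis.

Set Implicit Arguments.
Unset Strict Implicit.
Unset Printing Implicit Defensive.

Import Order.TTheory GRing.Theory Num.Theory.
Import numFieldNormedType.Exports.

Local Open Scope ring_scope.

Record uhypergraph (k : nat) (V : finType) := UHypergraph {
  hyperedges :> {set {set V}};
  hyperedges_uniform : [forall e in hyperedges, #|e| == k]
}.

HB.instance Definition _ (k : nat) (V : finType) :=
  [isSub for @hyperedges k V].
HB.instance Definition _ (k : nat) (V : finType) :=
  [Finite of uhypergraph k V by <:].

(* The colour set [k] = {1, ..., k} is rendered as 'I_k = {0, ..., k - 1}. *)
Definition rainbow_free (k : nat) (V : finType) (H : uhypergraph k V)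
    (c : {ffun V -> 'I_k}) : bool :=
  [forall i, exists v, c v == i] &&
  [forall e in hyperedges H, c @: e != [set: 'I_k]].

Definition rainbow_free_colourable (k : nat) (V : finType)
    (H : uhypergraph k V) : bool :=
  [exists c : {ffun V -> 'I_k}, rainbow_free H c].

(* The law of H^k_{n,p}: the product over all k-subsets e of V of Bernoulli(p)
   laws for the indicator of "e is a hyperedge". *)
Definition random_hypergraph_mass (R : realType) (k : nat) (V : finType)
    (p : R) (H : uhypergraph k V) : R :=
  \prod_(e : {set V} | #|e| == k)
    (if e \in hyperedges H then p else 1 - p).

Definition random_hypergraph_prob (R : realType) (k : nat) (V : finType)
    (p : R) (A : pred (uhypergraph k V)) : R :=
  \sum_(H : uhypergraph k V | A H) random_hypergraph_mass p H.

Lemma random_hypergraph_prob_setT (R : realType) (k : nat) (V : finType)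
    (p : R) : random_hypergraph_prob p (xpredT : pred (uhypergraph k V)) = 1.
Proof.
pose w (b : bool) : R := if b then p else 1 - p.
transitivity (\prod_(e : {set V} | #|e| == k) \sum_(b : bool) w b);
  last first.
  by rewrite big1 // => e _; rewrite big_bool /= addrC subrK.
rewrite (big_distr_big_dep false) /=.
pose f (H : uhypergraph k V) : {ffun {set V} -> bool} :=
  [ffun e => e \in hyperedges H].
have gP (g : {ffun {set V} -> bool}) :
    [forall e in [set e | g e && (#|e| == k)], #|e| == k].
  by apply/forall_inP => e; rewrite inE => /andP[].
rewrite [RHS](reindex f) /=; last first.
  exists (fun g => UHypergraph (gP g)) => [H _|g gK].
    apply/val_inj/setP => e /=; rewrite inE ffunE.
    by case: H => E /= /forall_inP HE; apply/andb_idr/HE.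
  apply/ffunP => e; rewrite !ffunE /= inE; apply/andb_idr => ge.
  by move/pfamilyP: gK => -[/fintype.subsetP/(_ e)+ _]; apply; rewrite inE ge.
apply: eq_big => [H|H _].
  symmetry; apply/pfamilyP; split => //.
  apply/fintype.subsetP => e; rewrite inE ffunE eqbF_neg negbK => eH.
  by have /forall_inP := hyperedges_uniform H; apply.
by apply: eq_bigr => e _; rewrite ffunE.
Qed.

Local Open Scope classical_set_scope.

(* f << g, i.e. f n / g n --> 0. As x / 0 = 0 here, the quotient is required to
   make sense for all large n; without this, g = 0 would dominate every f. *)
Definition much_smaller (R : realType) (f g : nat -> R) : Prop :=
  (\forall n \near \oo, g n != 0) /\ (f n / g n @[n --> \oo] --> (0 : R)).

Definition threshold_with_limits (R : realType) (k : nat) (r : nat -> R)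
    (A : forall n, pred (uhypergraph k 'I_n)) (l0 l1 : R) : Prop :=
  forall p : nat -> R, (forall n, 0 <= p n <= 1) ->
    (much_smaller p r ->
       random_hypergraph_prob (p n) (A n) @[n --> \oo] --> l0) /\
    (much_smaller r p ->
       random_hypergraph_prob (p n) (A n) @[n --> \oo] --> l1).

Definition is_threshold (R : realType) (k : nat) (r : nat -> R)
    (A : forall n, pred (uhypergraph k 'I_n)) : Prop :=
  threshold_with_limits r A 0 1 \/ threshold_with_limits r A 1 0.

Definition pstar (R : realType) (k n : nat) : R :=
  (k%:R - 1) * (ln n%:R / n%:R).

(* Main.v *)
(* Below the threshold, fix a set T of k - 2 vertices. By the second moment
   method, with high probability some set T + v lies in no hyperedge; giving its
   k - 1 vertices private colours and all other vertices the last colour is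
   then rainbow-free.

   Above the threshold, take a union bound over the surjective colourings c. If
   j is a most frequent colour of c and m vertices are not coloured j, then at
   least n m / k^2 of the k-sets are rainbow, so c is rainbow-free with
   probability at most x^m, where x = exp (- p n / k^2). Summing x^m over all j
   and all nonconstant c gives k ((1 + (k - 1) x)^n - 1), which tends to 0. *)
Require Import Defs.
From HB Require Import structures.
From mathcomp Require Import all_boot all_order all_algebra.
From mathcomp Require Import all_classical all_reals all_analysis.
From mathcomp Require Import zify ring lra.

Set Implicit Arguments.
Unset Strict Implicit.
Unset Printing Implicit Defensive.

Import Order.TTheory GRing.Theory Num.Theory.
Import numFieldNormedType.Exports.

Local Open Scope classical_set_scope.
Local Open Scope ring_scope.

(** * Probabilities under the product law, and the second moment bound *)

Lemma sum_uhypergraph_prod (R : realType) (k : nat) (V : finType)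
    (w : {set V} -> bool -> R) :
  \sum_(H : uhypergraph k V) \prod_(e : {set V} | #|e| == k)
    w e (e \in hyperedges H) =
  \prod_(e : {set V} | #|e| == k) \sum_(b : bool) w e b.
Proof.
rewrite (big_distr_big_dep false) /=.
pose f (H : uhypergraph k V) : {ffun {set V} -> bool} :=
  [ffun e => e \in hyperedges H].
have gP (g : {ffun {set V} -> bool}) :
    [forall e in [set e | g e && (#|e| == k)]%SET, #|e| == k].
  by apply/forall_inP => e; rewrite inE => /andP[].
(* Hypergraphs correspond exactly to the choice functions that are [false] outside the [k]-sets. *)
rewrite [RHS](reindex f) /=; last first.
  exists (fun g => UHypergraph (gP g)) => [H _|g gK].
    apply/val_inj/setP => e /=; rewrite inE ffunE.
    by case: H => E /= /forall_inP HE; apply/andb_idr/HE.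
  apply/ffunP => e; rewrite !ffunE /= inE; apply/andb_idr => ge.
  by move/pfamilyP: gK => -[/fintype.subsetP/(_ e)+ _]; apply; rewrite inE ge.
apply: eq_big => [H|H _].
  symmetry; apply/pfamilyP; split => //.
  apply/fintype.subsetP => e; rewrite inE ffunE eqbF_neg negbK => eH.
  by have /forall_inP := hyperedges_uniform H; apply.
by apply: eq_bigr => e _; rewrite ffunE.
Qed.

Section Probability.
Variables (R : realType) (k : nat) (V : finType) (p : R).
Hypothesis p01 : 0 <= p <= 1.

Implicit Types (H : uhypergraph k V) (A B : pred (uhypergraph k V)).
Implicit Types F G : {set {set V}}.

Definition k_uniform F := {in F, forall e : {set V}, #|e| = k}.

(** The common shape of the events below: [F] will be the star of [k - 1] vertices below the
    threshold, and the rainbow [k]-sets of a colouring above it. *)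
Definition avoids F H := [disjoint hyperedges H & F]%B.

Lemma avoidsU F G H : avoids (F :|: G) H = avoids F H && avoids G H.
Proof.
rewrite /avoids !(fintype.disjoint_sym (mem (hyperedges H))).
by rewrite -!finset.setI_eq0 finset.setIUl finset.setU_eq0.
Qed.

Lemma k_uniformU F G : k_uniform F -> k_uniform G -> k_uniform (F :|: G).
Proof. by move=> uF uG e /finset.setUP[/uF|/uG]. Qed.

Lemma random_hypergraph_mass_ge0 H : 0 <= random_hypergraph_mass p H.
Proof.
by apply: prodr_ge0 => e _; case: ifP => _; case/andP: p01; rewrite ?subr_ge0.
Qed.

Lemma random_hypergraph_probE A :
  random_hypergraph_prob p A =
  \sum_H random_hypergraph_mass p H * (A H)%:R.
Proof.
rewrite /random_hypergraph_prob big_mkcond; apply: eq_bigr => H _.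
by case: (A H); rewrite (mulr1, mulr0).
Qed.

Lemma random_hypergraph_prob_ge0 A : 0 <= random_hypergraph_prob p A.
Proof. by apply: sumr_ge0 => H _; exact: random_hypergraph_mass_ge0. Qed.

Lemma random_hypergraph_probC A :
  random_hypergraph_prob p A = 1 - random_hypergraph_prob p (predC A).
Proof.
apply/eqP; rewrite eq_sym subr_eq -(random_hypergraph_prob_setT k V p).
by rewrite {1}/random_hypergraph_prob (bigID A).
Qed.

Lemma random_hypergraph_prob_le A B : subpred A B ->
  random_hypergraph_prob p A <= random_hypergraph_prob p B.
Proof.
move=> AB; rewrite !random_hypergraph_probE; apply: ler_sum => H _.
rewrite ler_wpM2l ?random_hypergraph_mass_ge0// ler_nat.
by case: (A H) (AB H) => // ->.
Qed.

Lemma random_hypergraph_prob_union (I : finType) (P : pred I)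
    (B : I -> pred (uhypergraph k V)) A :
  (forall H, A H -> exists2 i, P i & B i H) ->
  random_hypergraph_prob p A <= \sum_(i | P i) random_hypergraph_prob p (B i).
Proof.
move=> AB; rewrite random_hypergraph_probE.
under [leRHS]eq_bigr do rewrite random_hypergraph_probE.
rewrite [leRHS]exchange_big /=; apply: ler_sum => H _; rewrite -mulr_sumr.
rewrite ler_wpM2l ?random_hypergraph_mass_ge0// -natr_sum ler_nat.
case AH: (A H) => //; have [i Pi BiH] := AB H AH.
by rewrite (bigD1 i)//= BiH.
Qed.

(** Distinct [k]-sets are present independently, so each member of [F] costs a factor [1 - p];
    uniformity places all of [F] among the possible edges. *)
Lemma random_hypergraph_prob_avoids F : k_uniform F ->
  random_hypergraph_prob p (avoids F) = (1 - p) ^+ #|F|.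
Proof.
move=> uF; rewrite random_hypergraph_probE.
(* The indicator of [avoids F] splits into one factor per [k]-set, which merges with the edge
   weight. *)
pose w (e : {set V}) b : R :=
  (if b then p else 1 - p) * (~~ (b && (e \in F)))%:R.
transitivity (\sum_(H : uhypergraph k V) \prod_(e : {set V} | #|e| == k)
    w e (e \in hyperedges H)).
  apply: eq_bigr => H _; rewrite big_split /=; congr (_ * _).
  rewrite -natr_prod; congr _%:R.
  case: (boolP (avoids F H)) => [/pred0P dF|/pred0Pn[e /andP[/= eH eF]]].
    by rewrite big1// => e _; rewrite (dF e : _ && _ = _).
  by rewrite (bigD1 e) ?uF//= eH eF mul0n.
rewrite sum_uhypergraph_prod.
transitivity (\prod_(e : {set V} | #|e| == k) if e \in F then 1 - p else 1).
  apply: eq_bigr => e _; rewrite big_bool /w /=.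
  by case: (e \in F); rewrite /= ?mulr1 ?mulr0 ?add0r// addrC subrK.
rewrite -big_mkcondr /= (eq_bigl (mem F)) ?prodr_const// => e /=.
by apply: andb_idl => /uF/eqP.
Qed.

(* Chebyshev for the number of avoided families; the variance is small because
   the families are almost disjoint, so that avoiding them is almost
   independent. *)
Lemma random_hypergraph_prob_avoids_none (I : finType) (P : {set I})
    (F : I -> {set {set V}}) (m : nat) :
  p < 1 -> (forall i, i \in P -> k_uniform (F i)) ->
  (forall i, i \in P -> (#|F i| <= m)%N) ->
  {in P &, forall i j, i != j -> (#|F i :&: F j| <= 1)%N} ->
  (0 < #|P|)%N ->
  random_hypergraph_prob p (fun H => [forall i in P, ~~ avoids (F i) H]) <=
    (#|P|%:R * (1 - p) ^+ m)^-1 + p / (1 - p).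
Proof.
move=> p1 uF cF FI P0.
set q := 1 - p; have q0 : 0 < q by rewrite subr_gt0.
have q1 : q <= 1 by rewrite gerBl; case/andP: p01.
set none := fun H => _.
pose mu : R := \sum_(i in P) q ^+ #|F i|.
pose X H : R := \sum_(i in P) (avoids (F i) H)%:R.
pose E (f : uhypergraph k V -> R) := \sum_H random_hypergraph_mass p H * f H.
have Eavoids G : k_uniform G -> E (fun H => (avoids G H)%:R) = q ^+ #|G|.
  by move=> uG; rewrite -random_hypergraph_prob_avoids// random_hypergraph_probE.
have E1 : E (fun _ => 1) = 1.
  rewrite -[RHS](random_hypergraph_prob_setT k V p).
  by rewrite random_hypergraph_probE.
have EX : E X = mu.
  rewrite /E; under eq_bigr do rewrite mulr_sumr.
  by rewrite exchange_big; apply: eq_bigr => i iP; rewrite -Eavoids//; exact: uF.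
have EXX : E (fun H => X H * X H) =
    \sum_(i in P) \sum_(j in P) q ^+ #|F i :|: F j|.
  transitivity (E (fun H => \sum_(i in P) \sum_(j in P)
      (avoids (F i :|: F j) H)%:R)).
    apply: eq_bigr => H _; congr (_ * _); rewrite mulr_suml.
    apply: eq_bigr => i _; rewrite mulr_sumr; apply: eq_bigr => j _.
    by rewrite -natrM mulnb avoidsU.
  rewrite /E; under eq_bigr do rewrite mulr_sumr.
  rewrite exchange_big; apply: eq_bigr => i iP.
  under eq_bigr do rewrite mulr_sumr.
  rewrite exchange_big; apply: eq_bigr => j jP.
  by rewrite -Eavoids//; apply: k_uniformU; exact: uF.
(* The diagonal contributes [mu]. Off the diagonal, an overlap of at most one edge lowers the
   exponent [#|F i| + #|F j|] by at most one, whence a single division by [q]. *)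
have EXX_le : E (fun H => X H * X H) <= mu + mu ^+ 2 / q.
  rewrite EXX expr2 [mu * mu]mulr_suml mulr_suml {1}/mu -big_split /=.
  apply: ler_sum => i iP; rewrite mulr_sumr mulr_suml (bigD1 i)//= finset.setUid.
  rewrite lerD//; apply: (@le_trans _ _ (\sum_(j in P | j != i)
      q ^+ #|F i| * q ^+ #|F j| / q)).
    apply: ler_sum => j /andP[jP ji]; rewrite ler_pdivlMr// -exprSr -exprD.
    apply: ler_wiXn2l; rewrite ?(ltW q0)//.
    by rewrite -cardsUI -addn1 leq_add2l FI// eq_sym.
  rewrite [leRHS](bigD1 i)//= lerDr.
  by rewrite !mulr_ge0 ?exprn_ge0 ?invr_ge0// ltW.
have mu_ge : #|P|%:R * q ^+ m <= mu.
  rewrite -sum1_card natr_sum mulr_suml; apply: ler_sum => i iP.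
  by rewrite mul1r; apply: ler_wiXn2l; rewrite ?(ltW q0) ?cF.
have low0 : 0 < #|P|%:R * q ^+ m by rewrite mulr_gt0 ?exprn_gt0 ?ltr0n.
have mu0 : 0 < mu by exact: lt_le_trans mu_ge.
(* On [none] the count [X] vanishes, so its squared deviation is [mu ^+ 2]. *)
have cheb : random_hypergraph_prob p none * mu ^+ 2 <=
    E (fun H => (X H - mu) ^+ 2).
  rewrite random_hypergraph_probE mulr_suml; apply: ler_sum => H _.
  rewrite -mulrA ler_wpM2l ?random_hypergraph_mass_ge0//.
  case nH: (none H); last by rewrite mul0r sqr_ge0.
  suff -> : X H = 0 by rewrite mul1r sub0r sqrrN.
  by apply: big1 => i iP; move/forall_inP: nH => /(_ i iP)/negbTE ->.
have var : E (fun H => (X H - mu) ^+ 2) = E (fun H => X H * X H) - mu ^+ 2.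
  have sqrE Y m' : E (fun H => (Y H - m') ^+ 2) =
      E (fun H => Y H * Y H) - 2 * m' * E Y + m' ^+ 2 * E (fun _ => 1).
    rewrite /E !mulr_sumr -sumrB -big_split /=.
    by apply: eq_bigr => H _; ring.
  by rewrite sqrE EX E1; ring.
apply: (@le_trans _ _ (mu^-1 + p / q)); last first.
  by rewrite lerD2r lef_pV2.
have mu2 : 0 < mu ^+ 2 by rewrite exprn_gt0.
rewrite -(ler_pM2r mu2) (le_trans cheb)// var (le_trans (lerB EXX_le (lexx _)))//.
(* Both sides agree, because [1 / q - 1 = p / q]. *)
rewrite le_eqVlt; apply/orP; left; apply/eqP.
by rewrite /q; field; rewrite (gt_eqF mu0) (gt_eqF q0).
Qed.

End Probability.

(** * Stars of vertex sets, and the colourings obtained by avoiding them *)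

Definition star (k : nat) (V : finType) (S : {set V}) : {set {set V}} :=
  [set e : {set V} | (#|e| == k) && (S \subset e)]%SET.

Section Star.
Variables (k : nat) (V : finType).

Lemma star_uniform (S : {set V}) : k_uniform k (star k S).
Proof. by move=> e; rewrite inE => /andP[/eqP]. Qed.

(** An edge of the star is [S] plus one vertex, so the vertices suffice to index the star. *)
Lemma card_star (S : {set V}) : #|S|.+1 = k -> (#|star k S| <= #|V|)%N.
Proof.
move=> cS.
have /subset_leq_card/leq_trans : star k S \subset [set v |: S | v : V]%SET.
  apply/fintype.subsetP => e; rewrite inE => /andP[/eqP ce Se].
  have : (0 < #|e :\: S|)%N by rewrite cardsDS// ce -cS subSnn.
  case/card_gt0P => v; rewrite inE => /andP[vS ve].
  apply/imsetP; exists v => //; apply/esym/eqP.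
  by rewrite eqEcard finset.subUset finset.sub1set ve Se cardsU1 vS ce -cS add1n leqnn.
by apply; exact: leq_imset_card.
Qed.

(** A common edge contains [v], [w] and [T], which already make up [k] vertices, so it is their
    union. *)
Lemma card_starI (T : {set V}) v w : (#|T|.+2 = k)%N ->
  v \notin T -> w \notin T -> v != w ->
  (#|star k (v |: T) :&: star k (w |: T)| <= 1)%N.
Proof.
move=> cT vT wT vw; rewrite -(cards1 (v |: (w |: T))%SET).
apply/subset_leq_card/fintype.subsetP => e; rewrite !inE.
move=> /andP[/andP[/eqP ce /fintype.subsetP ve] /andP[_ we]].
rewrite eq_sym eqEcard finset.subUset we finset.sub1set ve ?finset.setU11//=.
by rewrite !cardsU1 !inE negb_or vw vT wT ce -cT.
Qed.

(* Give the [k - 1] vertices of [S] distinct colours, and all the others the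
   remaining colour: an edge with all colours contains [S]. *)
Lemma avoids_star_colourable (S : {set V}) (H : uhypergraph k V) :
  #|S|.+1 = k -> (k <= #|V|)%N -> avoids (star k S) H ->
  rainbow_free_colourable H.
Proof.
move=> cS kV; case: k / cS H kV => H kV aH.
(* Outside [S], [index] takes its default value [#|S|], which serves as the last colour. *)
pose c := [ffun v => inord (index v (enum S)) : 'I_#|S|.+1].
have cE v : c v = index v (enum S) :> nat.
  by rewrite ffunE inordK// ltnS cardE index_size.
have surj i : exists v, c v = i.
  have [iS|Si] := ltnP i #|S|.
    have /card_gt0P[x0 _] : (0 < #|S|)%N by apply: leq_ltn_trans iS.
    exists (nth x0 (enum S) i); apply/val_inj; rewrite /= cE index_uniq//.
      by rewrite -cardE.
    by rewrite enum_uniq.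
  have : (0 < #|~: S|)%N by rewrite -(ltn_add2l #|S|) addn0 cardsC.
  case/card_gt0P => v; rewrite inE => vS; exists v; apply/val_inj; rewrite /= cE.
  rewrite memNindex ?mem_enum// -cardE; apply/eqP; rewrite eqn_leq Si /=.
  by rewrite -ltnS.
apply/existsP; exists c; apply/andP; split.
  by apply/forallP => i; have [v /eqP cv] := surj i; apply/existsP; exists v.
apply/forall_inP => e eH; apply/negP => /eqP ce.
have /forall_inP/(_ e eH) ke := hyperedges_uniform H.
move/pred0P: aH => /(_ e) /=; rewrite eH inE ke /=.
move=> /negP; apply; apply/fintype.subsetP => v vS.
(* The colour of [v] occurs in [e], and no vertex other than [v] has it. *)
have : c v \in c @: e by rewrite ce inE.
case/imsetP => w we /(congr1 val); rewrite /= !cE => vw.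
suff -> : v = w by [].
apply: (index_inj v _ _ vw); rewrite ?mem_enum//.
by rewrite -mem_enum -index_mem -vw index_mem mem_enum.
Qed.

End Star.

(** * Counting the rainbow [k]-sets of a colouring *)

Section RainbowEdges.
Variables (k : nat) (V : finType) (c : {ffun V -> 'I_k}).

Definition rainbow_edges : {set {set V}} :=
  [set e : {set V} | (#|e| == k) && (c @: e == [set: 'I_k])]%SET.

Definition colour_class i := [set v | c v == i]%SET.

Lemma rainbow_edges_uniform : k_uniform k rainbow_edges.
Proof. by move=> e; rewrite inE => /andP[/eqP]. Qed.

Lemma rainbow_free_avoids (H : uhypergraph k V) :
  rainbow_free H c -> avoids rainbow_edges H.
Proof.
case/andP => _ /forall_inP rf; apply/pred0P => e /=.
apply/negP => /andP[eH]; rewrite inE => /andP[_].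
exact/negP/rf.
Qed.

(** Choosing one vertex in each colour class yields a rainbow [k]-set, from which the colours
    recover the choice. *)
Lemma card_rainbow_edges :
  (\prod_i #|colour_class i| <= #|rainbow_edges|)%N.
Proof.
pose fam := finfun.family (fun i => mem (colour_class i)).
have famP f : f \in fam -> forall i, c (f i) = i.
  by move=> /familyP ff i; have /[!inE]/eqP := ff i.
have <- : #|fam| = (\prod_i #|colour_class i|)%N.
  by rewrite card_family foldrE big_map big_enum.
have inj : {in fam &, injective (fun f : {ffun 'I_k -> V} => f @: 'I_k)}.
  move=> f g /famP fc /famP gc fg; apply/ffunP => i.
  have : f i \in f @: 'I_k by apply: imset_f.
  rewrite fg => /imsetP[j _ fj]; rewrite fj; congr (g _).
  by rewrite -(gc j) -fj fc.
rewrite -(card_in_imset inj).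
apply/subset_leq_card/fintype.subsetP => _ /imsetP[f /famP fc ->].
rewrite inE card_imset ?card_ord ?eqxx /=; last first.
  by move=> i j fij; rewrite -(fc i) fij fc.
apply/eqP/setP => i; rewrite inE; apply/imsetP.
by exists (f i) => //; apply: imset_f.
Qed.

(* With [j] the most frequent colour, the class of [j] has at least [|V| / k]
   elements, and the product of the other, nonempty, classes exceeds each of
   their sizes, hence the average of these. *)
Lemma card_rainbow_edges_majority : (0 < k)%N -> (forall i, exists v, c v = i) ->
  exists j,
    (#|V| * #|[set v | c v != j]%SET| <= k * k * #|rainbow_edges|)%N.
Proof.
move=> k0 surj; pose s i := #|colour_class i|.
have [|j maxj] := @bigop.eq_bigmax 'I_k s; first by rewrite card_ord.
exists j.
have sum_s (P : pred 'I_k) : #|[set v | P (c v)]%SET| = (\sum_(i | P i) s i)%N.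
  rewrite -sum1_card (partition_big c P) => [|v]; last by rewrite inE.
  apply: eq_bigr => i Pi; rewrite sum1dep_card; apply: eq_card => v.
  by rewrite !inE andbC; case: eqP => // ->.
have s0 i : (0 < s i)%N.
  by have [v cv] := surj i; apply/card_gt0P; exists v; rewrite inE cv.
have sum_k a : (\sum_(i < k) a = k * a)%N by rewrite sum_nat_const card_ord.
have V_le : (#|V| <= k * s j)%N.
  rewrite -cardsT; have := sum_s xpredT => /= ->.
  rewrite -sum_k; apply: leq_sum => i _.
  by rewrite -maxj; exact: bigop.leq_bigmax.
have rest_le : (#|[set v | c v != j]%SET| <= k * \prod_(i | i != j) s i)%N.
  rewrite (sum_s (predC1 j)) -sum_k big_mkcond /=.
  apply: leq_sum => i _; case: ifP => // ij.
  by rewrite (bigD1 i)//= leq_pmulr// prodn_gt0.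
apply: leq_trans (leq_mul V_le rest_le) _.
rewrite mulnACA leq_mul2l (leq_trans _ card_rainbow_edges) ?orbT//.
by rewrite [leqRHS](bigD1 j).
Qed.

End RainbowEdges.

(** * Bounds for a fixed vertex set *)

Section ColourableBounds.
Variables (R : realType) (k : nat) (V : finType) (p : R).
Hypotheses (k_ge2 : (2 <= k)%N) (p01 : 0 <= p <= 1).

(** The second moment bound applied to the stars of [v |: T], for [T] of size [k - 2] and [v]
    outside [T]. *)
Lemma prob_not_colourable_le : p < 1 -> (k <= #|V|)%N ->
  random_hypergraph_prob p (predC (@rainbow_free_colourable k V)) <=
    ((#|V| - (k - 2))%:R * (1 - p) ^+ #|V|)^-1 + p / (1 - p).
Proof.
move=> p1 kV; pose T := [set v in take (k - 2) (enum V)]%SET.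
have cT : #|T| = (k - 2)%N.
  rewrite cardsE (card_uniqP _) ?take_uniq ?enum_uniq// size_takel// -cardE.
  by rewrite leq_subLR (leq_trans kV)// leq_addl.
have cTc : #|~: T| = (#|V| - (k - 2))%N by rewrite -cT -(cardsC T) addKn.
have kT : (#|T|.+2 = k)%N by rewrite cT -addn2 subnK.
have cvT v : v \in ~: T -> #|v |: T|.+1 = k.
  by rewrite inE => vT; rewrite cardsU1 vT add1n.
rewrite -cTc; apply: le_trans.
  apply: (@random_hypergraph_prob_le _ _ _ _ p01 _
    (fun H => [forall v in ~: T, ~~ avoids (star k (v |: T)) H])).
  move=> H /=; apply: contraNT => /forall_inPn[v vT /negPn].
  exact: avoids_star_colourable (cvT v vT) kV.
apply: random_hypergraph_prob_avoids_none => //.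
- by move=> v vT; exact: star_uniform.
- by move=> v vT; exact/card_star/cvT.
- by move=> v w; rewrite !finset.in_setC => vT wT vw; apply: card_starI.
- by rewrite cTc subn_gt0 (leq_trans _ kV)// ltn_subrL (ltnW k_ge2).
Qed.

Lemma prob_colourable_le :
  random_hypergraph_prob p (@rainbow_free_colourable k V) <=
    k%:R * (expR (#|V|%:R * (k%:R * expR (- (p * #|V|%:R / (k * k)%:R)))) - 1).
Proof.
set x := expR (- _); have k0 : (0 < k)%N by exact: ltn_trans k_ge2.
have x0 : 0 < x by exact: expR_gt0.
pose minor (j : 'I_k) (c : {ffun V -> 'I_k}) := [set v | c v != j]%SET.
(* Excluding the constant colouring, of weight [x ^+ 0 = 1], produces the [- 1] in the bound. *)
pose P (jc : 'I_k * {ffun V -> 'I_k}) := (jc.2 != [ffun=> jc.1]) &&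
  (#|V| * #|minor jc.1 jc.2| <= k * k * #|rainbow_edges jc.2|)%N.
have weightE (j : 'I_k) (c : {ffun V -> 'I_k}) :
    \prod_v (if c v == j then 1 else x) = x ^+ #|minor j c|.
  rewrite -prodr_const [RHS]big_mkcond; apply: eq_bigr => v _.
  by rewrite inE; case: eqP.
(* The sum factorises over the vertices: each contributes [1] for colour [j] and [x] for each of the
   other [k - 1] colours. *)
have sum_weight (j : 'I_k) : \sum_(c : {ffun V -> 'I_k}) x ^+ #|minor j c| =
    (1 + x *+ k.-1) ^+ #|V|.
  under eq_bigr do rewrite -weightE.
  rewrite -(bigA_distr_bigA (fun (_ : V) i => if i == j then 1 else x)).
  rewrite prodr_const; congr (_ ^+ _).
  rewrite (bigD1 j)//= eqxx; congr (_ + _).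
  rewrite (eq_bigr (fun=> x)) => [|i /negbTE -> //].
  by rewrite sumr_const cardC1 card_ord.
apply: (@le_trans _ _ (\sum_(jc | P jc) x ^+ #|minor jc.1 jc.2|)).
  apply: le_trans (@random_hypergraph_prob_union _ _ _ _ p01 _ P
    (fun jc => avoids (rainbow_edges jc.2)) _ _) _.
    move=> H /existsP[c rf]; have av := rainbow_free_avoids rf.
    have surj i : exists v, c v = i.
      by move: rf => /andP[/forallP/(_ i)/existsP[v /eqP]]; exists v.
    have [j cj] := card_rainbow_edges_majority k0 surj.
    exists (j, c) => //; rewrite /P /= cj andbT.
    apply/negP => /eqP cE.
    (* As [k >= 2], a constant colouring would miss some colour. *)
    have [i ij] : exists i : 'I_k, i != j.
      apply/existsP; rewrite -negb_forall; apply/negP => /forallP allj.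
      have := cardC1 j; rewrite card_ord eq_card0 => [|i]; last first.
        by rewrite !inE allj.
      by case: (k) k_ge2 => [|[]].
    by have [v cv] := surj i; move: ij; rewrite -cv cE ffunE eqxx.
  apply: ler_sum => -[j c] /andP[_ /= cj].
  rewrite random_hypergraph_prob_avoids//; last exact: rainbow_edges_uniform.
  (* With [r] rainbow edges and [m] vertices not coloured [j], [(1 - p)^r <= exp (- p r) <= x^m],
     since [#|V| m <= k^2 r]. *)
  apply: (@le_trans _ _ (expR (- p) ^+ #|rainbow_edges c|)).
    rewrite lerXn2r ?nnegrE ?expR_ge0 ?subr_ge0//; first by case/andP: p01.
    exact: expR_ge1Dx.
  rewrite -!expRM_natl ler_expR !mulrN lerN2.
  have kk0 : 0 < (k * k)%:R :> R by rewrite ltr0n muln_gt0 k0.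
  rewrite mulrA ler_pdivrMr//.
  rewrite [leLHS](_ : _ = p * (#|V| * #|minor j c|)%:R); last first.
    by rewrite natrM; ring.
  rewrite [leRHS](_ : _ = p * (k * k * #|rainbow_edges c|)%:R); last first.
    by rewrite !natrM; ring.
  by rewrite ler_wpM2l ?ler_nat//; case/andP: p01.
apply: (@le_trans _ _ (\sum_(jc | jc.2 != [ffun=> jc.1])
    x ^+ #|minor jc.1 jc.2|)).
  rewrite [leRHS](bigID (fun jc => P jc)) /=.
  rewrite [X in X + _](eq_bigl P) => [|jc]; last by rewrite /P andbA andbb.
  by rewrite lerDl sumr_ge0// => jc _; rewrite exprn_ge0// ltW.
rewrite -(pair_big_dep xpredT (fun j c => c != [ffun=> j])
  (fun j c => x ^+ #|minor j c|)) /=.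
rewrite -[X in X%:R * _](card_ord k) mulr_natl -sumr_const.
apply: ler_sum => j _.
have minor0 : #|minor j [ffun=> j]| = 0%N.
  by apply: eq_card0 => v; rewrite !inE ffunE eqxx.
have := sum_weight j; rewrite (bigD1 [ffun=> j])//= minor0 expr0.
move/(canRL (addKr _)); rewrite addrC => ->; rewrite lerB//.
(* Here [1 + (k - 1) x <= 1 + k x <= exp (k x)]. *)
rewrite expRM_natl lerXn2r ?nnegrE ?expR_ge0 ?addr_ge0 ?mulrn_wge0 ?(ltW x0)//.
apply: le_trans (expR_ge1Dx _); rewrite lerD2l -[leLHS]mulr_natl ler_wpM2r ?(ltW x0)//.
by rewrite ler_nat leq_pred.
Qed.

End ColourableBounds.

(** * Explicit estimates in [n] *)

Section Asymptotics.
Variables (R : realType) (k n : nat) (p : R).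
Hypotheses (k_ge2 : (2 <= k)%N) (p01 : 0 <= p <= 1).

(** Of the two terms of the second moment bound, the first is at most [2 / sqrt n] and the second at
    most [1 / sqrt n]. *)
Lemma prob_not_colourable_le_sqrt : (2 * k <= n)%N ->
  p * n%:R <= ln n%:R / 4 ->
  random_hypergraph_prob p (predC (@rainbow_free_colourable k 'I_n)) <=
    3 * Num.sqrt (n%:R^-1).
Proof.
move=> kn pn; have n0 : (0 < n)%N by rewrite (leq_trans _ kn)// muln_gt0 (ltnW k_ge2).
have n1 : 1 <= n%:R :> R by rewrite ler1n.
(* [s] is the square root of [n], written as an exponential so that [1 + l <= expR l] bounds [l] by
   [s]. *)
pose l : R := ln n%:R / 2; pose s := expR l.
have lnE : ln n%:R = 2 * l by rewrite /l; field.
have s2 : n%:R = s ^+ 2 by rewrite /s -expRM_natl -lnE lnK// posrE ltr0n.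
have s0 : 0 < s by exact: expR_gt0.
have ls : l <= s by apply: le_trans (expR_ge1Dx l); rewrite lerDr.
have l0 : 0 <= l by rewrite divr_ge0// ln_ge0.
have s1 : 1 <= s by rewrite -expR0 ler_expR.
case/andP: (p01) => p0 _.
(* From [p s^2 = p n <= l / 2 <= s / 2]. *)
have ps : p * s <= 1 / 2.
  rewrite -(ler_pM2r s0) -mulrA -expr2 -s2 (le_trans pn)//.
  by rewrite lnE; lra.
have p_half : p <= 1 / 2 by apply: le_trans ps; rewrite ler_peMr.
have q0 : 0 < 1 - p by lra.
have -> : Num.sqrt n%:R^-1 = s^-1 :> R.
  by rewrite sqrtrV// s2 sqrtr_sqr gtr0_norm.
have pq : p / (1 - p) <= 2 * p by rewrite ler_pdivrMr//; nra.
(* [1 / (1 - p) = 1 + p / (1 - p) <= 1 + 2 p <= exp (2 p)], and [2 p n <= l]. *)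
have qn : ((1 - p) ^+ n)^-1 <= s.
  rewrite -exprVn; apply: (@le_trans _ _ (expR (2 * p) ^+ n)).
    rewrite lerXn2r ?nnegrE ?expR_ge0 ?invr_ge0 ?(ltW q0)//.
    apply: le_trans (expR_ge1Dx _).
    rewrite (_ : (1 - p)^-1 = 1 + p / (1 - p)) ?lerD2l//.
    by field; exact: lt0r_neq0.
  by rewrite -expRM_natl ler_expR; lra.
have N_ge : n%:R / 2 <= (n - (k - 2))%:R :> R.
  by rewrite ler_pdivrMr// -natrM ler_nat; lia.
apply: le_trans.
  apply: (prob_not_colourable_le k_ge2 p01); first lra.
  by rewrite card_ord (leq_trans _ kn)// leq_pmull.
rewrite card_ord invfM.
have half_n0 : 0 < n%:R / 2 :> R by rewrite divr_gt0 ?ltr0n.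
have NV : (n - (k - 2))%:R^-1 <= 2 / s ^+ 2.
  rewrite -s2 -[leRHS]invrK invf_div lef_pV2 ?posrE//.
  exact: lt_le_trans N_ge.
have first_le : (n - (k - 2))%:R^-1 * ((1 - p) ^+ n)^-1 <= 2 / s.
  rewrite (_ : 2 / s = 2 / s ^+ 2 * s); last by field; exact: lt0r_neq0.
  by rewrite ler_pM ?invr_ge0 ?exprn_ge0// ltW.
have second_le : p / (1 - p) <= 1 / s.
  by rewrite (le_trans pq)// ler_pdivlMr//; lra.
lra.
Qed.

(** The hypothesis makes [p n / k^2] at least [2 ln n], so [exp (- p n / k^2) <= n^-2] and the
    exponent drops to [k / n]. *)
Lemma prob_colourable_le_expR : (0 < n)%N ->
  2 * (k * k)%:R * ln n%:R <= p * n%:R ->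
  random_hypergraph_prob p (@rainbow_free_colourable k 'I_n) <=
    k%:R * (expR (k%:R * n%:R^-1) - 1).
Proof.
move=> n0 pn; apply: (le_trans (@prob_colourable_le _ _ 'I_n _ k_ge2 p01)).
have n0' : 0 < n%:R :> R by rewrite ltr0n.
rewrite card_ord ler_wpM2l// lerD2r ler_expR mulrCA ler_wpM2l//.
rewrite [leRHS](_ : _ = n%:R * expR (- (2 * ln n%:R))); last first.
  rewrite expRN expRM_natl lnK ?posrE// expr2 invfM mulrA divff ?mul1r//.
  exact: lt0r_neq0.
rewrite ler_wpM2l// ler_expR lerN2 ler_pdivlMr//; last first.
  by rewrite ltr0n muln_gt0 ltnW.
by rewrite mulrAC.
Qed.

Lemma pstar_gt0 : (2 <= n)%N -> 0 < pstar R k n.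
Proof.
move=> n2; rewrite /pstar mulr_gt0 ?subr_gt0 ?ltr1n// divr_gt0 ?ln_gt0 ?ltr1n//.
by rewrite ltr0n ltnW.
Qed.

End Asymptotics.

(** * Passage to the limit *)

Lemma invn_cvg0 (R : realType) : (n%:R^-1 : R) @[n --> \oo] --> (0 : R).
Proof.
apply/gtr0_cvgV0; last exact: cvgr_idn.
by near=> n; rewrite ltr0n; near: n; exact: nbhs_infty_gt.
Unshelve. all: by end_near. Qed.

Lemma rainbow_free_colourable_prob_cvg1 (R : realType) (k : nat)
    (p : nat -> R) : (2 <= k)%N -> (forall n, 0 <= p n <= 1) ->
  much_smaller p (pstar R k) ->
  random_hypergraph_prob (p n) (@rainbow_free_colourable k 'I_n)
    @[n --> \oo] --> (1 : R).
Proof.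
move=> k2 p01 [_ p_small].
have k1 : 0 < k%:R - 1 :> R by rewrite subr_gt0 ltr1n.
apply: (@squeeze_cvgr _ _ _ _ (fun n => 1 - 3 * Num.sqrt n%:R^-1)
  (fun=> 1)); last exact: cvg_cst.
  (* With this ratio to [pstar], the factor [k - 1] cancels and [p n * n] is at most [ln n / 4]. *)
  have eps0 : 0 < 1 / (4 * (k%:R - 1)) :> R by rewrite divr_gt0// mulr_gt0.
  near=> n.
  have n2 : (2 <= n)%N by near: n; exact: nbhs_infty_ge.
  have n0 : 0 < n%:R :> R by rewrite ltr0n ltnW.
  have pst0 := pstar_gt0 R k2 n2.
  have pn : p n * n%:R <= ln n%:R / 4.
    have : `|p n / pstar R k n| <= 1 / (4 * (k%:R - 1)).
      by near: n; exact: cvgr0_norm_le.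
    move/(le_trans (ler_norm _)); rewrite ler_pdivrMr// -(ler_pM2r n0).
    move=> /le_trans; apply; rewrite le_eqVlt; apply/orP; left; apply/eqP.
    by rewrite /pstar; field; rewrite !lt0r_neq0.
  rewrite random_hypergraph_probC; apply/andP; split.
    rewrite lerD2l lerN2; apply: prob_not_colourable_le_sqrt => //.
    by near: n; exact: nbhs_infty_ge.
  by rewrite gerBl random_hypergraph_prob_ge0.
rewrite -[X in _ --> X](_ : 1 - 3 * Num.sqrt 0 = 1); last first.
  by rewrite sqrtr0 mulr0 subr0.
apply: cvgB; first exact: cvg_cst.
apply: cvgMr; apply: continuous_cvg; first exact: sqrt_continuous.
exact: invn_cvg0.
Unshelve. all: by end_near. Qed.

Lemma rainbow_free_colourable_prob_cvg0 (R : realType) (k : nat)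
    (p : nat -> R) : (2 <= k)%N -> (forall n, 0 <= p n <= 1) ->
  much_smaller (pstar R k) p ->
  random_hypergraph_prob (p n) (@rainbow_free_colourable k 'I_n)
    @[n --> \oo] --> (0 : R).
Proof.
move=> k2 p01 [p_neq0 p_large].
have k1 : 1 <= k%:R - 1 :> R by rewrite lerBrDr (ler_nat R 2 k).
have kk0 : 0 < (k * k)%:R :> R by rewrite ltr0n muln_gt0 ltnW.
apply: (@squeeze_cvgr _ _ _ _ (fun=> 0)
  (fun n => k%:R * (expR (k%:R * n%:R^-1) - 1))); first 1 last.
- exact: cvg_cst.
- rewrite -[X in _ --> X](_ : k%:R * (expR (k%:R * 0) - 1) = 0); last first.
    by rewrite mulr0 expR0 subrr mulr0.
  apply: cvgMr; apply: cvgB; last exact: cvg_cst.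
  apply: continuous_cvg; first exact: continuous_expR.
  by apply: cvgMr; exact: invn_cvg0.
(* This ratio gives [p n * n >= 2 k^2 (k - 1) ln n], and [k - 1 >= 1] removes the extra factor. *)
have eps0 : 0 < 1 / (2 * (k * k)%:R) :> R by rewrite divr_gt0// mulr_gt0.
near=> n.
have n2 : (2 <= n)%N by near: n; exact: nbhs_infty_ge.
have n0 : 0 < n%:R :> R by rewrite ltr0n ltnW.
have pn0 : 0 < p n.
  (* Nonvanishing is the first clause of [much_smaller]; at [p n = 0] the quotient would be [0] and
     carry no information. *)
  rewrite lt0r; apply/andP; split; first by near: n.
  by case/andP: (p01 n).
have ln0 : 0 <= ln n%:R :> R by rewrite ln_ge0// ler1n ltnW.
rewrite random_hypergraph_prob_ge0//=.
apply: prob_colourable_le_expR => //; first exact: ltnW.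
have : `|pstar R k n / p n| <= 1 / (2 * (k * k)%:R).
  by near: n; exact: cvgr0_norm_le.
move/(le_trans (ler_norm _)); rewrite ler_pdivrMr// -(ler_pM2r n0).
rewrite /pstar mulrA divfK ?lt0r_neq0// => le_p.
apply: (@le_trans _ _ (2 * (k * k)%:R * ((k%:R - 1) * ln n%:R))).
  apply: ler_wpM2l; first by rewrite mulr_ge0// ltW.
  by rewrite ler_peMl.
rewrite mulrC -ler_pdivlMr ?mulr_gt0// (le_trans le_p)//.
by rewrite div1r -mulrA mulrC.
Unshelve. all: by end_near. Qed.

Theorem theorem7 (R : realType) (k : nat) (hk : (2 <= k)%N) :
  is_threshold (pstar R k) (fun n => @rainbow_free_colourable k 'I_n) /\
  forall p : nat -> R, (forall n, 0 <= p n <= 1) ->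
    (much_smaller p (pstar R k) ->
       random_hypergraph_prob (p n) (@rainbow_free_colourable k 'I_n)
         @[n --> \oo] --> (1 : R)) /\
    (much_smaller (pstar R k) p ->
       random_hypergraph_prob (p n) (@rainbow_free_colourable k 'I_n)
         @[n --> \oo] --> (0 : R)).
Proof.
(* The reversed alternative of [is_threshold] holds: being colourable is a decreasing property. *)
suff limits : threshold_with_limits (pstar R k)
    (fun n => @rainbow_free_colourable k 'I_n) 1 0 by split; first right.
move=> p p01; split.
  exact: rainbow_free_colourable_prob_cvg1.
exact: rainbow_free_colourable_prob_cvg0.
Qed.
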